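(* Let $N\ge 1$ be an integer, $\beta>0$, and let $\varepsilon_1\le\varepsilon_2\le\cdots$ be the (infinite) sequence of single-particle energy eigenvalues, listed with multiplicity, with $\sum_{i}e^{-\beta\varepsilon_i}<\infty$. Let $Z_{FD}(\beta,N)$ be the canonical partition function of the ideal Fermi gas of $N$ particles with this single-particle spectrum. Then $$Z_{FD}(\beta,N)=(1^N)\left(e^{-\beta\varepsilon_1},e^{-\beta\varepsilon_2},\dots\right),$$ where $(1^N)(x_1,x_2,\dots)$ denotes the $S$-function corresponding to the integer partition $(1^N)=(1,1,\dots,1)$ of $N$.
   Context: Canonical partition function: for an $N$-particle system, $Z(\beta,N)=\sum_s e^{-\beta E_s}$, summed over all states $s$ of the system with energies $E_s$. For an ideal Fermi gas of $N$ particles, a state is a sequence of occupation numbers $(n_i)_{i\ge1}$ with each $n_i\in\{0,1\}$ and $\sum_i n_i=N$, and its energy is $\sum_i n_i\varepsilon_i$. Integer partitions: list all $P(N)$ integer partitions of $N$ as $(\lambda)_1,\dots,(\lambda)_{P(N)}$ in decreasing lexicographic order, parts in descending order, so $(\lambda)_1=(N)$ and $(\lambda)_{P(N)}=(1^N)$. Let $a_{J,m}$ be the number of times $m$ occurs as a part of $(\lambda)_J$, and $g_J=N!\left(\prod_{j=1}^N j^{a_{J,j}}a_{J,j}!\right)^{-1}$. $S$-function (Schur function) of infinitely many variables corresponding to $(\lambda)_I$: $$(\lambda)_I(x_1,x_2,\dots)=\sum_{J=1}^{P(N)}\frac{g_J}{N!}\,\chi_J^I\prod_{m=1}^{N}\Big(\sum_i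 x_i^m\Big)^{a_{J,m}},$$ where $\chi^I_J$ is the value of the irreducible character of the symmetric group $S_N$ indexed by the partition $(\lambda)_I$ on the conjugacy class of cycle type $(\lambda)_J$ (with the convention that $(N)$ indexes the trivial character and $(1^N)$ the sign character). In particular, $(1^N)(x_1,x_2,\dots)$ is the case $I=P(N)$. *)

(* Defs.v *)
From HB Require Import structures.
From mathcomp Require Import all_boot all_order all_fingroup all_algebra.
From mathcomp Require Import all_solvable all_field all_character.
From mathcomp Require Import all_classical all_reals all_analysis.

Set Implicit Arguments.
Unset Strict Implicit.
Unset Printing Implicit Defensive.

Import Order.TTheory GRing.Theory Num.Theory.
Import numFieldNormedType.Exports.

Local Open Scope classical_set_scope.
Local Open Scope ring_scope.

Definition is_intpart (N : nat) (l : seq nat) : bool :=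
  [&& sorted geq l, 0%N \notin l & sumn l == N].

(* A partition of N has at most N parts, each at most N, so filtering the
   finite type of such sequences misses none; each partition is listed once. *)
Definition intparts (N : nat) : seq (seq nat) :=
  [seq l <- [seq map val (bseqval b) | b : N.-bseq 'I_N.+1] | is_intpart N l].

(* a_m is count_mem m l; z_l = \prod_j j ^ a_j * a_j`! is the order of the
   centralizer of a permutation of cycle type l. *)
Definition class_size (R : fieldType) (N : nat) (l : seq nat) : R :=
  N`!%:R / (\prod_(1 <= j < N.+1) (j ^ count_mem j l * (count_mem j l)`!))%:R.

Section SpechtCharacter.
Variables (F : fieldType) (N : nat) (l : seq nat).

Let G : {group 'S_N} := [set: 'S_N]%G.

(* The Young tableau of shape l is filled with 0, ..., N-1 row after row:
   k lies in row [reshape_index l k] and column [reshape_offset l k]. *)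
Definition row_stab : {set 'S_N} :=
  [set s : 'S_N |
    [forall k : 'I_N, reshape_index l (s k) == reshape_index l k]]%SET.

Definition col_stab : {set 'S_N} :=
  [set s : 'S_N |
    [forall k : 'I_N, reshape_offset l (s k) == reshape_offset l k]]%SET.

(* \sum_p \sum_q sgn(q) p q, as a vector of the regular representation, i.e.
   an element of the group algebra F[S_N]. *)
Definition young_symmetrizer : 'rV[F]_#|G| :=
  gring_row (\sum_(p in row_stab) \sum_(q in col_stab)
               (-1) ^+ odd_perm q *: regular_repr F G (p * q)%g).

(* Over a field of characteristic 0, the right ideal of F[S_N] generated by the
   Young symmetrizer is the absolutely irreducible (Specht) module indexed by
   l, defined over the rationals, so its character does not depend on F. The
   shape (N) gives the trivial character and (1^N) the sign character. *)
Definition specht_repr :=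
  submod_repr (cyclic_mx_module (regular_repr F G) young_symmetrizer).

Definition specht_char (s : 'S_N) : F := \tr (specht_repr s).

End SpechtCharacter.

Definition cycle_type (N : nat) (s : 'S_N) : seq nat :=
  sort geq [seq #|pred_of_set X| | X <- enum (porbits s)].

(* The default 1 is irrelevant: every partition m of N is a cycle type. *)
Definition char_value (F : fieldType) (N : nat) (l m : seq nat) : F :=
  specht_char F l (odflt 1%g [pick s : 'S_N | cycle_type s == m]).

Definition power_sum (R : realType) (m : nat) (x : nat -> R) : R :=
  limn (series (fun i => x i ^+ m)).

Definition S_function (R : realType) (N : nat) (l : seq nat) (x : nat -> R)
    : R :=
  \sum_(mu <- intparts N)
    class_size R N mu / N`!%:R * char_value R N l mu *
    \prod_(1 <= m < N.+1) power_sum m x ^+ count_mem m mu.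

Definition canonical_Z (R : realType) (S : choiceType) (states : set S)
    (E : S -> R) (beta : R) : \bar R :=
  \esum_(s in states) (expR (- (beta * E s)))%:E.

(* The sum of occupation numbers is taken in \bar R, so that it equals N only
   for sequences of finite support. *)
Definition fermi_states (R : realType) (N : nat) : set (nat -> nat) :=
  [set n | (forall i, n i = 0%N \/ n i = 1%N) /\
           (\sum_(0 <= i <oo) ((n i)%:R : R)%:E = (N%:R : R)%:E)%E].

(* The series is eventually constant for a state of [fermi_states]. *)
Definition state_energy (R : realType) (eps : nat -> R) (n : nat -> nat) : R :=
  limn (series (fun i => (n i)%:R * eps i)).

Definition Z_FD (R : realType) (eps : nat -> R) (beta : R) (N : nat) : \bar R :=
  canonical_Z (fermi_states R N) (state_energy eps) beta.

(* Main.v *)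
Require Import Defs.
From HB Require Import structures.
From mathcomp Require Import all_boot all_order all_fingroup all_algebra.
From mathcomp Require Import all_character ring.
From mathcomp Require Import all_classical all_reals all_analysis.
Set Implicit Arguments.
Unset Strict Implicit.
Unset Printing Implicit Defensive.
Import Order.TTheory GRing.Theory Num.Theory.
Import numFieldNormedType.Exports.
Local Open Scope classical_set_scope.
Local Open Scope ring_scope.

(* For the shape (1^N) every permutation stabilizes the columns and only the
   identity stabilizes the rows, so the Specht module is the line spanned by
   \sum_q sgn(q) q and its character is the sign. The S-function is then
   \sum_mu (-1)^(N - l(mu)) p_mu / z_mu. Removing one part k from a partition
   shows that these sums satisfy Newton's recursion
   N E_N = \sum_(1 <= k <= N) (-1)^(k-1) p_k E_(N-k),
   which the elementary symmetric polynomials in x_0, ..., x_(n-1) satisfy as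
   well, by induction on n. The latter are the partition functions of the gas
   restricted to the first n levels, and both sides converge as n grows: the
   power sums by comparison with \sum_i x_i, the partition functions because
   each state occupies finitely many levels. *)

(** * Integer partitions and the removal of a part *)

Lemma mem_intparts (N : nat) (mu : seq nat) :
  (mu \in intparts N) = is_intpart N mu.
Proof.
rewrite mem_filter; case: (boolP (is_intpart N mu)) => //=.
move=> /and3P[_ mu0 /eqP muN].
have le_size : (size mu <= N)%N.
  rewrite -muN -sum1_size sumnE big_seq [leqRHS]big_seq.
  apply: leq_sum => i imu.
  by rewrite lt0n; apply: contraNneq mu0 => <-.
have le_part i : i \in mu -> (i < N.+1)%N.
  by move=> imu; rewrite ltnS -muN sumnE (big_rem i) //= leq_addr.
have sz : (size (map (@inord N) mu) <= N)%N by rewrite size_map.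
apply/fintype.imageP; exists (Bseq sz) => //=.
rewrite -map_comp -[LHS]map_id; apply/eq_in_map => i imu /=.
by rewrite inordK ?le_part.
Qed.

Lemma uniq_intparts (N : nat) : uniq (intparts N).
Proof.
apply: filter_uniq; rewrite map_inj_uniq ?enum_uniq //.
by move=> b c /(inj_map val_inj) /val_inj.
Qed.

Lemma sorted_sort_geq (s : seq nat) : sorted geq (sort geq s).
Proof. by apply: sort_sorted => m n; apply: leq_total. Qed.

Lemma sort_geq_perm (s t : seq nat) :
  sorted geq s -> perm_eq s t -> sort geq t = s.
Proof.
move=> ss st; apply: (@sorted_eq _ geq).
- by move=> ? ? ? /= h1 h2; apply: leq_trans h2 h1.
- by move=> m n /=; rewrite andbC; apply: anti_leq.
- exact: sorted_sort_geq.
- exact: ss.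
- by rewrite perm_sort perm_sym.
Qed.

(** Deleting one copy of [k] with [rem] inverts inserting [k] and sorting again. This reindexes sums
    over the partitions of [N] that contain [k]. *)
Lemma intparts_with_part (N k : nat) : (0 < k <= N)%N ->
  perm_eq [seq mu <- intparts N | k \in mu]
          [seq sort geq (k :: nu) | nu <- intparts (N - k)].
Proof.
case/andP=> k0 kN; apply: uniq_perm.
- by rewrite filter_uniq ?uniq_intparts.
- rewrite map_inj_in_uniq ?uniq_intparts // => mu nu.
  rewrite !mem_intparts => /and3P[smu _ _] /and3P[snu _ _] eq_sort.
  have: perm_eq (k :: mu) (k :: nu).
    by rewrite -(perm_sort geq) eq_sort perm_sort.
  rewrite perm_cons => mu_nu; rewrite -(sort_geq_perm smu (perm_refl _)).
  by rewrite (sort_geq_perm snu) // perm_sym.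
move=> mu; rewrite mem_filter mem_intparts; apply/andP/mapP.
- case=> kmu /and3P[smu mu0 /eqP muN].
  have := perm_to_rem kmu => pmu.
  exists (rem k mu); last by rewrite (sort_geq_perm smu).
  rewrite mem_intparts; apply/and3P; split.
  + apply: subseq_sorted smu; last exact: rem_subseq.
    by move=> ? ? ? /= h1 h2; apply: leq_trans h2 h1.
  + by apply: contra mu0 => /mem_rem.
  + by rewrite -muN (perm_sumn pmu) /= addKn.
- case=> nu; rewrite mem_intparts => /and3P[snu nu0 /eqP nuN] ->.
  rewrite mem_sort mem_head; split=> //; apply/and3P; split.
  + exact: sorted_sort_geq.
  + by rewrite mem_sort inE negb_or nu0 andbT eq_sym -lt0n.
  + by rewrite (perm_sumn (permEl (perm_sort _ _))) /= nuN subnKC.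
Qed.

(** * The power-sum expansion and its Newton recursion *)

Definition centralizer_order (M : nat) (mu : seq nat) : nat :=
  \prod_(1 <= j < M.+1) (j ^ count_mem j mu * (count_mem j mu)`!)%N.

(* The summand of mu in the expansion of the elementary symmetric function in
   the power sums; M is any bound on the parts of mu. *)
Definition power_term (R : numFieldType) (p : nat -> R) (M : nat)
    (mu : seq nat) : R :=
  (-1) ^+ (sumn mu + size mu) / (centralizer_order M mu)%:R *
  \prod_(1 <= m < M.+1) p m ^+ count_mem m mu.

Definition power_expansion (R : numFieldType) (p : nat -> R) (N : nat) : R :=
  \sum_(mu <- intparts N) power_term p N mu.

Lemma centralizer_order_gt0 (M : nat) (mu : seq nat) :
  (0 < centralizer_order M mu)%N.
Proof.
rewrite /centralizer_order big_nat; apply: prodn_cond_gt0 => j /andP[j0 _].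
by rewrite muln_gt0 expn_gt0 j0 fact_gt0.
Qed.

Lemma count_mem_intpart (N j : nat) (mu : seq nat) :
  is_intpart N mu -> (N < j)%N -> count_mem j mu = 0%N.
Proof.
case/and3P=> _ _ /eqP <- lt_j; apply/count_memPn; apply: contraTN lt_j => jmu.
by rewrite -leqNgt sumnE (big_rem j) //= leq_addr.
Qed.

(** All parts are at most [N], so the factors beyond [N] have exponent 0 and equal 1. Partitions of
    [N - k] and of [N] can thus be compared under one bound. *)
Lemma power_term_widen (R : numFieldType) (p : nat -> R) (N M : nat)
    (mu : seq nat) :
  is_intpart N mu -> (N <= M)%N -> power_term p M mu = power_term p N mu.
Proof.
move=> muN NM; rewrite /power_term /centralizer_order.
rewrite (@big_cat_nat _ _ _ N.+1 1 M.+1) //=.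
rewrite [X in _ * X](@big_cat_nat _ _ _ N.+1) //=.
have no_part j : (N < j < M.+1)%N -> count_mem j mu = 0%N.
  by case/andP=> Nj _; apply: count_mem_intpart Nj.
rewrite [X in (_ * X)%:R]big_nat [X in (_ * X)%:R]big1 => [|j /no_part ->] //.
rewrite [X in _ * (_ * X)]big_nat [X in _ * (_ * X)]big1 => [|j /no_part ->] //.
by rewrite muln1 mulr1.
Qed.

Lemma power_term_perm (R : numFieldType) (p : nat -> R) (M : nat)
    (mu nu : seq nat) :
  perm_eq mu nu -> power_term p M mu = power_term p M nu.
Proof.
move=> mu_nu; rewrite /power_term /centralizer_order.
rewrite (perm_sumn mu_nu) (perm_size mu_nu).
by congr (_ / _%:R * _); apply: eq_bigr => j _; rewrite (seq.permP mu_nu).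
Qed.

(** The new part multiplies the centralizer order by [k] times the new multiplicity of [k], which
    the factor on the left cancels. It raises sum plus length by [k.+1], whence the sign. *)
Lemma power_term_cons (R : numFieldType) (p : nat -> R) (M k : nat)
    (nu : seq nat) : (0 < k <= M)%N ->
  (k * count_mem k (k :: nu))%:R * power_term p M (k :: nu) =
  (-1) ^+ k.+1 * p k * power_term p M nu.
Proof.
move=> /andP[k0 kM]; have kr : k \in index_iota 1 M.+1.
  by rewrite mem_index_iota k0 ltnS kM.
have others (j : nat) : (j != k) -> count_mem j (k :: nu) = count_mem j nu.
  by move=> jk /=; rewrite eq_sym (negPf jk).
have order_cons : centralizer_order M (k :: nu) =
    (k * count_mem k (k :: nu) * centralizer_order M nu)%N.
  rewrite /centralizer_order (bigD1_seq k) ?iota_uniq //=.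
  rewrite [X in _ = (_ * X)%N](bigD1_seq k) ?iota_uniq //= eqxx add1n.
  rewrite (eq_bigr (fun j => (j ^ count_mem j nu * (count_mem j nu)`!)%N)).
    by rewrite factS expnS; ring.
  by move=> j /others /= ->.
set a := count_mem k (k :: nu); have c0 : (k * a)%:R != 0 :> R.
  by rewrite pnatr_eq0 -lt0n muln_gt0 k0 /a /= eqxx.
have prod_cons : \prod_(1 <= m < M.+1) p m ^+ count_mem m (k :: nu) =
    p k * \prod_(1 <= m < M.+1) p m ^+ count_mem m nu.
  rewrite (bigD1_seq k) ?iota_uniq //=.
  rewrite [X in _ = _ * X](bigD1_seq k) ?iota_uniq //=.
  rewrite eqxx add1n exprS -mulrA; congr (_ * (_ * _)).
  by apply: eq_bigr => j /others /= ->.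
have z0 : (centralizer_order M nu)%:R != 0 :> R.
  by rewrite pnatr_eq0 -lt0n centralizer_order_gt0.
rewrite /power_term prod_cons order_cons -/a [in X in _ / X]natrM.
have -> : (sumn (k :: nu) + size (k :: nu) = k.+1 + (sumn nu + size nu))%N.
  by rewrite /=; ring.
rewrite exprD; move: _%:R _%:R c0 z0 => c z c0 z0.
by field; rewrite c0 z0.
Qed.

(** Write N as the sum of k a_k(mu) over k and exchange the sums. For fixed k only the partitions
    containing k survive, and deleting one k from them leaves the partitions of N - k. *)
Lemma power_expansion_newton (R : numFieldType) (p : nat -> R) (N : nat) :
  N%:R * power_expansion p N =
  \sum_(1 <= k < N.+1) (-1) ^+ k.+1 * p k * power_expansion p (N - k).
Proof.
rewrite /power_expansion mulr_sumr /=.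
have sum_parts mu : mu \in intparts N ->
    N%:R = \sum_(1 <= k < N.+1) (k * count_mem k mu)%:R :> R.
  rewrite mem_intparts => /and3P[_ mu0 /eqP muN]; rewrite -natr_sum; congr _%:R.
  have part_range : {in mu, forall k, k \in index_iota 1 N.+1}.
    move=> k kmu; rewrite mem_index_iota lt0n ltnS -muN sumnE (big_rem k) //=.
    by rewrite leq_addr andbT; apply: contraNneq mu0 => <-.
  rewrite -[LHS]muN sumnE; transitivity
    (\sum_(j <- mu) \sum_(1 <= k < N.+1) if j == k then k else 0)%N.
    rewrite [LHS]big_seq [RHS]big_seq; apply: eq_bigr => j /part_range jr.
    rewrite (bigD1_seq j) ?iota_uniq //= eqxx big1 ?addn0 // => i /negPf.
    by rewrite eq_sym => ->.
  rewrite exchange_big /=; apply: eq_bigr => k _.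
  rewrite -big_mkcond /= big_const_seq iter_addn_0; congr (_ * _)%N.
transitivity (\sum_(mu <- intparts N) \sum_(1 <= k < N.+1)
    (k * count_mem k mu)%:R * power_term p N mu).
  rewrite [LHS]big_seq [RHS]big_seq; apply: eq_bigr => mu /sum_parts {1}->.
  by rewrite big_distrl.
rewrite exchange_big /= big_nat [RHS]big_nat; apply: eq_bigr => k.
rewrite ltnS => kN.
rewrite (bigID (fun mu => k \in mu)) /= [X in _ + X]big1 ?addr0; last first.
  by move=> mu /count_memPn ->; rewrite muln0 mul0r.
rewrite -big_filter (perm_big _ (intparts_with_part kN)) /= big_map.
rewrite mulr_sumr [LHS]big_seq [RHS]big_seq; apply: eq_bigr => nu.
rewrite mem_intparts => nuN.
rewrite -(power_term_widen (M := N) _ nuN) ?leq_subr //.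
rewrite (power_term_perm _ _ (permEl (perm_sort geq (k :: nu)))).
rewrite -power_term_cons //.
by congr (_%:R * _); congr muln; rewrite (seq.permP (permEl (perm_sort _ _))).
Qed.

(** * Elementary symmetric polynomials and Newton's identities *)

(** The elementary symmetric polynomial of degree [N] in x_0, ..., x_(n-1), its monomials split by
    whether they contain the last variable. *)
Fixpoint elementary (R : comNzRingType) (x : nat -> R) (N n : nat) : R :=
  match N, n with
  | 0, _ => 1
  | _.+1, 0 => 0
  | N'.+1, n'.+1 => elementary x N n' + x n' * elementary x N' n'
  end.

Lemma elementary0 (R : comNzRingType) (x : nat -> R) (n : nat) :
  elementary x 0 n = 1.
Proof. by case: n. Qed.

Lemma elementaryS (R : comNzRingType) (x : nat -> R) (N n : nat) :
  elementary x N.+1 n.+1 = elementary x N.+1 n + x n * elementary x N n.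
Proof. by []. Qed.

Arguments elementary : simpl never.

(** Induction on the number of variables. The old power sums are handled by the identities in
    degrees N+1 and N; the powers of the new variable y telescope. *)
Lemma elementary_newton (R : comNzRingType) (x : nat -> R) (N n : nat) :
  N%:R * elementary x N n =
  \sum_(1 <= k < N.+1)
    (-1) ^+ k.+1 * (\sum_(0 <= i < n) x i ^+ k) * elementary x (N - k) n.
Proof.
elim: n N => [|n IHn] N.
  rewrite big1 => [|k _]; last by rewrite big_geq // mulr0 mul0r.
  by case: N => [|N]; rewrite /= ?mul0r ?mulr0.
case: N => [|N]; first by rewrite big_geq ?mul0r.
pose e := elementary x ^~ n; pose y := x n.
pose p k := \sum_(0 <= i < n) x i ^+ k.
(* This is the total contribution of the powers of y. Each summand is f (k+1) - f k; the separate
   term, for k = N+1, cancels the upper end f (N+1), and - f 1 = y e_N remains. *)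
have telescope : \sum_(1 <= k < N.+1) (-1) ^+ k.+1 * y ^+ k *
      (e (N.+1 - k)%N + y * e (N - k)%N) + (-1) ^+ N.+2 * y ^+ N.+1 = y * e N.
  pose f k := (-1) ^+ k * y ^+ k * e (N.+1 - k)%N.
  rewrite (eq_bigr (fun k => f k.+1 - f k)) => [|k _].
    rewrite telescope_sumr // /f subnn /e elementary0 !subSS subn0 !exprS.
    by ring.
  by rewrite /f subSS !exprS; ring.
have pS k : \sum_(0 <= i < n.+1) x i ^+ k = p k + y ^+ k.
  by rewrite big_nat_recr.
rewrite elementaryS [RHS]big_nat_recr //= subnn elementary0 mulr1 pS.
(* The left side is (N+1) e_(N+1) + y N e_N + y e_N, and the induction hypothesis expands the first
   two terms. *)
transitivity (\sum_(1 <= k < N.+1) (-1) ^+ k.+1 * p k * e (N.+1 - k)%N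
    + (-1) ^+ N.+2 * p N.+1
    + y * (\sum_(1 <= k < N.+1) (-1) ^+ k.+1 * p k * e (N - k)%N) + y * e N).
  have := IHn N.+1; rewrite big_nat_recr //= subnn elementary0 mulr1 => <-.
  by rewrite -IHn /e /y -!natr1; ring.
rewrite -telescope.
suff -> : \sum_(1 <= k < N.+1) (-1) ^+ k.+1 * (\sum_(0 <= i < n.+1) x i ^+ k)
      * elementary x (N.+1 - k) n.+1 =
    \sum_(1 <= k < N.+1) (-1) ^+ k.+1 * p k * e (N.+1 - k)%N
    + y * (\sum_(1 <= k < N.+1) (-1) ^+ k.+1 * p k * e (N - k)%N)
    + \sum_(1 <= k < N.+1) (-1) ^+ k.+1 * y ^+ k *
        (e (N.+1 - k)%N + y * e (N - k)%N).
  by ring.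
rewrite mulr_sumr -!big_split /= big_nat [RHS]big_nat.
apply: eq_bigr => k /andP[k0 kN].
by rewrite pS subSn // elementaryS /e /y; ring.
Qed.

(** Both sides obey the same recursion, which determines them from degree 0 because [N.+1] is
    nonzero in [R]. *)
Lemma power_expansion_elementary (R : numFieldType) (x : nat -> R) (N n : nat) :
  power_expansion (fun k => \sum_(0 <= i < n) x i ^+ k) N = elementary x N n.
Proof.
elim/ltn_ind: N => -[_|N IHN].
  rewrite elementary0 /power_expansion.
  have parts0 : perm_eq (intparts 0) [:: [::]].
    apply: uniq_perm; rewrite ?uniq_intparts // => -[|[|m] mu];
      rewrite mem_intparts inE // /is_intpart /= ?inE ?eqxx ?andbF //=.
  rewrite (perm_big _ parts0) big_seq1 /power_term /centralizer_order.
  by rewrite !big_geq // divr1 mulr1.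
apply: (@mulfI _ N.+1%:R); first by rewrite pnatr_eq0.
rewrite power_expansion_newton elementary_newton [LHS]big_nat [RHS]big_nat.
apply: eq_bigr => k /andP[k0 kN].
by rewrite IHN // ltn_subrL k0.
Qed.

(** * Permutations of prescribed cycle type *)

Lemma disjoint_blocks (T : eqType) (bs : seq (seq T)) (b c : seq T) (x : T) :
  uniq (flatten bs) -> b \in bs -> c \in bs -> x \in b -> x \in c -> b = c.
Proof.
elim: bs => //= d bs IH; rewrite cat_uniq => /and3P[_ /hasPn dis ubs].
have notin e : e \in bs -> x \in e -> x \notin d.
  by move=> ebs xe; apply: dis; apply/flattenP; exists e.
rewrite !inE => /predU1P[->|bbs] /predU1P[->|cbs] // xb xc.
- by case/negP: (notin _ cbs xc).
- by case/negP: (notin _ bbs xb).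
- exact: IH.
Qed.

(** The permutation sends each element to its cyclic successor inside its block; the cyclic
    predecessor is the inverse. *)
Lemma perm_of_blocks (T : finType) (bs : seq (seq T)) :
  uniq (flatten bs) -> (forall x, x \in flatten bs) ->
  exists s : {perm T}, forall b x, b \in bs -> x \in b -> porbit s x =i b.
Proof.
move=> ubs cover_bs.
pose block x := nth [::] bs (find (fun b : seq T => x \in b) bs).
have has_block x : has (fun b : seq T => x \in b) bs.
  by apply/hasP; have /flattenP[b] := cover_bs x; exists b.
have block_in x : block x \in bs by rewrite mem_nth // -has_find.
have mem_block x : x \in block x.
  exact: (@nth_find _ [::] (fun b : seq T => x \in b)).
have blockE b x : b \in bs -> x \in b -> block x = b.
  by move=> bbs xb; apply: (disjoint_blocks ubs _ _ (mem_block x)).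
have ub b : b \in bs -> uniq b.
  elim: (bs) ubs => //= d ds IH; rewrite cat_uniq => /and3P[ud _ uds].
  by rewrite inE => /predU1P[->|/IH]; last exact.
pose f x := next (block x) x.
have f_inj : injective f.
  apply: (can_inj (g := fun x => prev (block x) x)) => x.
  rewrite (blockE (block x)) ?mem_next //.
  by rewrite prev_next ?ub.
exists (perm f_inj) => b x bbs xb y.
have fb : fcycle f b.
  apply: cycle_from_next; first exact: ub.
  by move=> z zb /=; rewrite /f (blockE b).
rewrite -(fconnect_cycle fb xb); apply/porbitP/idP.
  case=> i ->; rewrite permX (eq_iter (permE f_inj)).
  exact: fconnect_iter.
move/iter_findex => <-; exists (findex f x y).
by rewrite permX (eq_iter (permE f_inj)).
Qed.

Lemma uniq_blocks (T : eqType) (bs : seq (seq T)) :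
  uniq (flatten bs) -> [::] \notin bs -> uniq bs.
Proof.
elim: bs => //= b bs IH; rewrite cat_uniq inE negb_or.
case/and3P=> _ /hasPn dis ubs /andP[b0 bs0]; rewrite IH // andbT.
case: b b0 dis => //= x b _ dis; apply/negP => bbs.
have /dis : x \in flatten bs.
  by apply/flattenP; exists (x :: b); rewrite ?mem_head.
by rewrite mem_head.
Qed.

(** The cycles are consecutive segments of the enumeration of ['I_N], of lengths [mu]. Hence the
    [pick] in [char_value] succeeds. *)
Lemma perm_of_cycle_type (N : nat) (mu : seq nat) : mu \in intparts N ->
  exists s : 'S_N, cycle_type s = mu.
Proof.
rewrite mem_intparts => /and3P[smu mu0 /eqP muN].
have size_enum : sumn mu = size (enum 'I_N) by rewrite size_enum_ord.
pose bs := reshape mu (enum 'I_N).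
have bs_enum : flatten bs = enum 'I_N by rewrite reshapeKr // size_enum.
have bs_mu : map size bs = mu by apply: reshapeKl; rewrite size_enum.
have ubs : uniq (flatten bs) by rewrite bs_enum enum_uniq.
have bs0 : [::] \notin bs.
  by apply: contra mu0 => bs0; rewrite -bs_mu; apply/mapP; exists [::].
have in_bs x : x \in flatten bs by rewrite bs_enum mem_enum.
have [s sP] := perm_of_blocks ubs in_bs; exists s.
have {}sP b x : b \in bs -> x \in b -> porbit s x = [set y in b]%SET.
  by move=> bbs xb; apply/setP => y; rewrite inE (sP b).
have nonempty b : b \in bs -> exists x, x \in b.
  by case: b => [|x b] bbs; [rewrite bbs in bs0|exists x; rewrite mem_head].
apply: sort_geq_perm => //.
(* The orbits are the blocks read as sets; no set repeats, since the blocks are nonempty and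
   disjoint. *)
have /(perm_map (fun X : {set 'I_N} => #|X|)) :
    perm_eq (enum (porbits s)) [seq [set x in b]%SET | b : seq 'I_N <- bs].
  apply: uniq_perm; first exact: enum_uniq.
    rewrite map_inj_in_uniq ?uniq_blocks // => b c bbs cbs /setP bc.
    have [x xb] := nonempty _ bbs.
    by apply: (disjoint_blocks ubs bbs cbs xb); have := bc x; rewrite !inE xb.
  move=> X; rewrite mem_enum; apply/imsetP/mapP => [[x _ ->]|[b bbs ->]].
    by have /flattenP[b bbs xb] := in_bs x; exists b => //; apply: sP.
  by have [x xb] := nonempty _ bbs; exists x => //; rewrite (sP b).
rewrite -map_comp => sizes.
rewrite perm_sym (permPl sizes) -[X in perm_eq _ X]bs_mu.
rewrite (_ : map _ bs = map size bs) //; apply/eq_in_map => b bbs /=.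
rewrite cardsE; apply/card_uniqP; rewrite -bs_mu in muN.
by have := ubs; elim: (bs) bbs => //= d ds IH; rewrite cat_uniq inE =>
  /predU1P[->|/IH {}IH] /and3P[].
Qed.

(** [odd_perm] is defined as the parity of N plus the number of orbits, and the orbits correspond to
    the parts. *)
Lemma odd_perm_cycle_type (N : nat) (s : 'S_N) (mu : seq nat) :
  cycle_type s = mu -> odd_perm s = odd (N + size mu).
Proof.
move=> <-; rewrite /cycle_type size_sort size_map -cardE oddD /odd_perm.
by rewrite card_ord.
Qed.

(** * The character of the column shape is the sign *)

Section SignCharacter.
Variables (F : fieldType) (N : nat).

Let G : {group 'S_N} := [set: 'S_N]%G.
Let u := young_symmetrizer F N (nseq N 1%N) : 'rV[F]_#|G|.
Let sign_sum := \sum_(q : 'S_N) (-1) ^+ odd_perm q *: regular_repr F G q.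

Lemma reshape_index_nseq1 (k : nat) :
  (k < N)%N -> reshape_index (nseq N 1%N) k = k.
Proof.
move=> kN; have kS : (k < sumn (nseq N 1))%N by rewrite sumn_nseq mul1n.
have := reshape_offsetP kS; have := reshape_indexP kS.
rewrite size_nseq => rN; rewrite nth_nseq rN ltnS leqn0 => /eqP c0.
rewrite -[RHS](reshape_indexK (nseq N 1%N)) c0 /flatten_index addn0.
by rewrite take_nseq 1?ltnW // sumn_nseq mul1n.
Qed.

Lemma reshape_offset_nseq1 (k : nat) :
  (k < N)%N -> reshape_offset (nseq N 1%N) k = 0%N.
Proof.
move=> kN; rewrite /reshape_offset reshape_index_nseq1 //.
by rewrite take_nseq 1?ltnW // sumn_nseq mul1n subnn.
Qed.

Lemma young_symmetrizer_column : u = gring_row sign_sum.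
Proof.
rewrite /u /young_symmetrizer; congr gring_row.
have row1 : row_stab N (nseq N 1%N) = [set 1%g]%SET.
  apply/setP => s; rewrite !inE; apply/forallP/eqP => [h|-> k]; last first.
    by rewrite perm1.
  apply/permP => k; rewrite perm1; apply: val_inj => /=.
  by have /eqP := h k; rewrite !reshape_index_nseq1.
have colT : col_stab N (nseq N 1%N) = [set: 'S_N]%SET.
  by apply/setP => s; rewrite !inE; apply/forallP => k;
    rewrite !reshape_offset_nseq1.
by rewrite row1 big_set1 colT; apply: eq_big => q; rewrite ?inE ?mul1g.
Qed.

(** Right translation by [s] permutes the summands and multiplies every sign by that of [s]. *)
Lemma sign_sum_act (s : 'S_N) :
  u *m regular_repr F G s = (-1) ^+ odd_perm s *: u.
Proof.
rewrite young_symmetrizer_column -gring_row_mul -linearZ; congr gring_row.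
rewrite /sign_sum mulmx_suml scaler_sumr.
rewrite [RHS](reindex_inj (mulIg s)) /=; apply: eq_bigr => q _.
rewrite -scalemxAl scalerA odd_permM repr_mxM ?inE //; congr (_ *: _).
by rewrite -signr_addb addbC -addbA addbb addbF.
Qed.

Lemma young_symmetrizer_neq0 : u != 0.
Proof.
apply/eqP => u0.
(* Only the summand q = 1 contributes to the coordinate at the identity, which is therefore 1. *)
have := congr1 (fun v : 'rV[F]__ => v 0 (gring_index G 1%g)) u0.
rewrite young_symmetrizer_column /sign_sum linear_sum /= summxE (bigD1 1%g) //=.
rewrite big1 => [|q q1].
  rewrite odd_perm1 linearZ /= !mxE gring_indexK ?inE // mulg1 !eqxx.
  rewrite mulr1 addr0.
  by move/eqP; rewrite oner_eq0.
rewrite linearZ /= !mxE gring_indexK ?inE // mul1g eqxx /=.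
rewrite -(inj_eq enum_val_inj) !gring_indexK ?inE // eq_sym (negPf q1).
by rewrite mulr0.
Qed.

Lemma specht_char_column (s : 'S_N) :
  specht_char F (nseq N 1%N) s = (-1) ^+ odd_perm s.
Proof.
rewrite /specht_char /specht_repr -/G -/u.
set U := cyclic_mx _ u; set modU := cyclic_mx_module _ _.
(* The enveloping algebra is spanned by the matrices of group elements, and each of them only
   rescales [u]. *)
have eqU : (U :=: u)%MS.
  apply/eqmxP; rewrite cyclic_mx_id andbT; apply/row_subP => i.
  have /cyclic_mxP[A] := row_sub i U.
  case/envelop_mxP=> a -> ->; rewrite mulmx_sumr summx_sub // => g _.
  by rewrite -scalemxAr sign_sum_act !scalemx_sub.
have -> : submod_repr modU s = ((-1) ^+ odd_perm s)%:M.
  have subU : (@val_submod _ _ U _ 1%:M <= u)%MS.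
    by rewrite -eqU val_submodP.
  have val_act : @val_submod _ _ U _ 1%:M *m regular_repr F G s =
      (-1) ^+ odd_perm s *: val_submod 1%:M.
    by have /submxP[D ->] := subU; rewrite -mulmxA sign_sum_act scalemxAr.
  by rewrite /= /submod_mx val_act linearZ /= val_submodK scalemx1.
by rewrite mxtrace_scalar eqU rank_rV young_symmetrizer_neq0 mulr1n.
Qed.

End SignCharacter.

Lemma char_value_column (F : fieldType) (N : nat) (mu : seq nat) :
  mu \in intparts N ->
  char_value F N (nseq N 1%N) mu = (-1) ^+ (N + size mu).
Proof.
move=> muN; rewrite /char_value specht_char_column -[RHS]signr_odd.
have [s0 s0mu] := perm_of_cycle_type muN.
case: pickP => [s /eqP smu|/(_ s0)]; last by rewrite s0mu eqxx.
by rewrite /= (odd_perm_cycle_type smu).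
Qed.

(** * Convergence of the power-sum expansion *)

Lemma cvg_power_expansion (R : realType) (x : nat -> R) (N : nat) :
  (forall k, (0 < k)%N -> cvgn (series (fun i => x i ^+ k))) ->
  (fun n => power_expansion (fun k => \sum_(0 <= i < n) x i ^+ k) N) @ \oo
    --> power_expansion (fun k => power_sum k x) N.
Proof.
move=> cvg_p; rewrite /power_expansion.
apply: (cvg_big (add_continuous (s := R))) => mu _.
rewrite /power_term; apply: cvgMl_tmp.
(* The range 1 <= k is kept as a side condition, because the power sums of exponent 0 diverge. *)
rewrite big_nat; under eq_cvg do rewrite big_nat.
apply: (cvg_big (@mul_continuous R)) => k /andP[k0 _].
have p_cvg : (fun n => \sum_(0 <= i < n) x i ^+ k) @ \oo --> power_sum k x.
  exact: cvg_p.
exact: (continuous_cvg _ (@exprn_continuous R (count_mem k mu) _) p_cvg).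
Qed.

(** * Fermi states and their truncation to finitely many levels *)

Lemma big_nat_stationary (T : Type) (idx : T) (op : Monoid.law idx)
    (f : nat -> T) (n m : nat) :
  (forall i, (n <= i)%N -> f i = idx) -> (n <= m)%N ->
  \big[op/idx]_(0 <= i < m) f i = \big[op/idx]_(0 <= i < n) f i.
Proof.
move=> f_idx nm; rewrite (big_cat_nat _ nm) //=.
have -> : \big[op/idx]_(n <= i < m) f i = idx.
  by rewrite big_nat big1 // => i /andP[ni _]; apply: f_idx.
exact: Monoid.mulm1.
Qed.

Definition states_below (N n : nat) : set (nat -> nat) :=
  [set s | [/\ forall i, s i = 0%N \/ s i = 1%N,
               forall i, (n <= i)%N -> s i = 0%N
             & (\sum_(0 <= i < n) s i)%N = N]].

(** The partial sums are natural numbers bounded by their limit N, so one of them equals N, and no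
    later level can be occupied. *)
Lemma fermi_statesE (R : realType) (N : nat) :
  fermi_states R N = \bigcup_n states_below N n.
Proof.
have partial (s : nat -> nat) n : (\sum_(0 <= i < n) ((s i)%:R : R)%:E =
    ((\sum_(0 <= i < n) s i)%N%:R : R)%:E)%E.
  by rewrite sumEFin natr_sum.
apply/seteqP; split=> s.
  case=> s01 sN.
  have le_N n : (\sum_(0 <= i < n) s i <= N)%N.
    rewrite -(ler_nat R) -lee_fin -partial -sN.
    by apply: nneseries_lim_ge => i _ _; rewrite lee_fin.
  have [n nN] : exists n, (\sum_(0 <= i < n) s i)%N = N.
    apply: contrapT => no_n.
    have lt_N n : (\sum_(0 <= i < n) s i < N)%N.
      by rewrite ltn_neqAle le_N andbT; apply/eqP => nN; apply: no_n; exists n.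
    (* Integers below N are at most N - 1, and this bound passes to the limit. *)
    have : ((N%:R : R)%:E <= (N.-1%:R : R)%:E)%E.
      rewrite -sN; apply: lime_le.
        by apply: is_cvg_nneseries => i _ _; rewrite lee_fin.
      apply: nearW => n; rewrite partial lee_fin ler_nat.
      by have := lt_N n; case: (N).
    (* The empty partial sum lies below N, which excludes the case N = 0 where [N.-1] equals N. *)
    by rewrite lee_fin ler_nat leqNgt; have := lt_N 0%N;
      case: (N) => //= k; rewrite ltnSn.
  exists n => //; split=> // i ni.
  have := le_N i.+1; rewrite (@big_cat_nat _ _ _ n) ?leqW //= nN.
  rewrite big_nat_recr //= addnA -[X in (_ <= X)%N]addn0 -addnA leq_add2l leqn0.
  by rewrite addn_eq0 => /andP[_ /eqP].
case=> n _ [s01 s0 sN]; split=> //.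
apply: lim_near_cst; first exact: ereal_hausdorff.
near=> m; rewrite partial -sN; congr (_%:R%:E).
by apply: big_nat_stationary => //; near: m; exact: nbhs_infty_ge.
Unshelve. all: by end_near. Qed.

Lemma state_weight (R : realType) (eps : nat -> R) (beta : R) (N n : nat)
    (s : nat -> nat) : states_below N n s ->
  expR (- (beta * state_energy eps s)) =
  \prod_(0 <= i < n) expR (- (beta * eps i)) ^+ s i.
Proof.
case=> _ s0 _.
have -> : state_energy eps s = \sum_(0 <= i < n) (s i)%:R * eps i.
  apply: lim_near_cst; first exact: Rhausdorff.
  near=> m; apply: big_nat_stationary; last by near: m; exact: nbhs_infty_ge.
  by move=> i ni; rewrite s0 // mul0r.
rewrite mulr_sumr -sumrN expR_sum; apply: eq_bigr => i _.
by rewrite -expRM_natl; congr expR; ring.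
Unshelve. all: by end_near. Qed.

(* The scalar c absorbs the weight of the last level when it is occupied. *)
Lemma esum_states_below (R : realType) (x : nat -> R) (c : R) (N n : nat) :
  0 <= c -> (forall i, 0 <= x i) ->
  \esum_(s in states_below N n) (c * \prod_(0 <= i < n) x i ^+ s i)%:E =
  (c * elementary x N n)%:E.
Proof.
move=> + x0; elim: n N c => [|n IHn] N c c0.
  have empty_sum (s : nat -> nat) : (\sum_(0 <= i < 0) s i = 0)%N.
    by rewrite big_geq.
  case: N => [|N]; last first.
    rewrite (_ : states_below _ _ = set0) ?esum_set0 ?mulr0 //.
    by apply/seteqP; split=> // s [_ _]; rewrite empty_sum.
  rewrite (_ : states_below 0 0 = [set fun=> 0%N]).
    by rewrite esum_set1 big_geq ?elementary0 ?mulr1 //.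
  apply/seteqP; split=> s; first by case=> _ s0 _; apply/funext => i; apply: s0.
  by move=> ->; split=> //; left.
have term_ge0 m s : (0 <= (c * \prod_(0 <= i < m) x i ^+ s i)%:E)%E.
  by rewrite lee_fin mulr_ge0 // prodr_ge0 // => i _; rewrite exprn_ge0.
(* Splitting on the occupation of level n mirrors the recursion defining [elementary]. *)
rewrite (esumID [set s | s n = 0%N]) //.
have -> : states_below N n.+1 `&` [set s | s n = 0%N] = states_below N n.
  apply/seteqP; split=> s.
    case=> -[s01 s0]; rewrite big_nat_recr //= => sN sn0; split=> //.
      by move=> i; rewrite leq_eqVlt => /predU1P[<-//|/s0].
    by rewrite -sN sn0 addn0.
  case=> s01 s0 sN; have sn0 := s0 n (leqnn n); split=> //; split=> //.
    by move=> i /ltnW /s0.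
  by rewrite big_nat_recr //= sn0 addn0.
rewrite (eq_esum (b := fun s => (c * \prod_(0 <= i < n) x i ^+ s i)%:E));
  last first.
  by move=> s [_ s0 _]; rewrite big_nat_recr //= s0 // mulr1.
rewrite IHn //; case: N => [|N].
  (* Without particles level n stays empty, in agreement with e_0 = 1 in any number of variables. *)
  rewrite (_ : _ `&` _ = set0) ?esum_set0 ?adde0 ?elementary0 //.
  apply/seteqP; split=> // s [[_ _]]; rewrite big_nat_recr //= => /eqP.
  by rewrite addn_eq0 => /andP[_ /eqP sn0] /(_ sn0).
pose occupy (s : nat -> nat) i := if i == n then 1%N else s i.
have -> : states_below N.+1 n.+1 `&` ~` [set s | s n = 0%N] =
    occupy @` states_below N n.
  apply/seteqP; split=> s.
    case=> -[s01 s0 sN] /= sn; have sn1 : s n = 1%N by case: (s01 n).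
    exists (fun i => if i == n then 0%N else s i); last first.
      by apply/funext => i; rewrite /occupy; case: eqP => // ->.
    split=> [i|i ni|].
    - by case: ifP => _; [left|apply: s01].
    - by case: eqP => // /eqP neq; apply: s0; rewrite ltn_neqAle eq_sym neq.
    - apply: succn_inj; rewrite -sN big_nat_recr //= sn1 addn1; congr _.+1.
      by apply: eq_big_nat => i /andP[_ /ltn_eqF ->].
  case=> t [t01 t0 tN] <-; split; last by rewrite /= /occupy eqxx.
  split=> [i|i ni|].
  - by rewrite /occupy; case: ifP => _; [right|apply: t01].
  - by rewrite /occupy gtn_eqF // t0 // ltnW.
  - rewrite big_nat_recr //= {2}/occupy eqxx addn1 -tN; congr _.+1.
    by apply: eq_big_nat => i /andP[_ /ltn_eqF]; rewrite /occupy => ->.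
(* [occupy] overwrites the value at n; it is injective here because the states it is applied to all
   vanish at n. *)
rewrite esum_image; last first.
  move=> s t /set_mem[_ s0 _] /set_mem[_ t0 _] /funeqP st; apply/funext => i.
  have := st i; rewrite /occupy; case: eqP => // -> _.
  by rewrite s0 // t0.
rewrite (eq_esum (b := fun s => (c * x n * \prod_(0 <= i < n) x i ^+ s i)%:E));
  last first.
  move=> s _; rewrite big_nat_recr //= {2}/occupy eqxx expr1.
  rewrite (_ : \prod_(0 <= i < n) _ = \prod_(0 <= i < n) x i ^+ s i).
    by congr EFin; ring.
  by apply: eq_big_nat => i /andP[_ /ltn_eqF]; rewrite /occupy => ->.
by rewrite IHn ?mulr_ge0 // -EFinD elementaryS; congr EFin; ring.
Qed.

(** The sets [states_below N n] increase and exhaust the states. The sum over states is a supremum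
    over finite subsets, each inside one of these sets; conversely every truncated sum is at most
    the full one. *)
Lemma Z_FD_lim (R : realType) (eps : nat -> R) (beta : R) (N : nat) :
  let e := elementary (fun i => expR (- (beta * eps i))) N in
  cvgn e -> Z_FD eps beta N = (limn e)%:E.
Proof.
set x := fun i => _; move=> e cvg_e; have x0 i : 0 <= x i by exact: expR_ge0.
have e_ge0 M n : 0 <= elementary x M n.
  elim: n M => [|n IHn] [|M] //; rewrite elementaryS addr_ge0 //.
  by rewrite mulr_ge0.
have e_mono : nondecreasing_seq e.
  apply/nondecreasing_seqP => n; rewrite /e; case: (N) => [|M].
    by rewrite !elementary0.
  by rewrite elementaryS lerDl mulr_ge0.
have sum_below n : \esum_(s in states_below N n)
    (expR (- (beta * state_energy eps s)))%:E = (e n)%:E.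
  rewrite -[e n]mul1r -(esum_states_below N n (@ler01 R) x0).
  by apply: eq_esum => s sn; rewrite mul1r (state_weight _ _ sn).
have below_mono : {homo states_below N : m n / (m <= n)%N >-> m `<=` n}.
  move=> m n mn s [s01 s0 sN]; split=> //.
    by move=> i ni; apply/s0/(leq_trans mn).
  by rewrite -sN; apply: big_nat_stationary.
rewrite /Z_FD /canonical_Z fermi_statesE; apply/eqP.
rewrite eq_le; apply/andP; split.
  apply: ge_ereal_sup => _ [X [finX XS] <-].
  have [n Xn] : exists n, X `<=` states_below N n.
    have /finite_seqP[r Xr] := finX; rewrite {X finX}Xr in XS *.
    elim: r XS => [|s r IHr] XS; first by exists 0%N.
    have [n rn] : exists n, [set` r] `<=` states_below N n.
      by apply: IHr => t tr; apply: XS => /=; rewrite inE tr orbT.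
    have [m _ sm] : (\bigcup_n states_below N n) s.
      by apply: XS; exact: mem_head.
    exists (maxn m n) => t /=; rewrite inE => /predU1P[->|/rn].
      by apply: below_mono sm; exact: leq_maxl.
    by apply: below_mono; exact: leq_maxr.
  apply: le_trans (_ : (e n)%:E <= _)%E; last first.
    by rewrite lee_fin nondecreasing_cvgn_le.
  by rewrite -sum_below esum_ge //; exists X.
rewrite -EFin_lim //; apply: lime_le.
  by apply: ereal_nondecreasing_is_cvgn => m n mn; rewrite lee_fin e_mono.
apply: nearW => n; rewrite /= -sum_below.
apply: ge_ereal_sup => _ [X [finX XS] <-].
by apply: ereal_sup_ubound; exists X => //; split=> // s /XS; exists n.
Qed.

(** * The column S-function and the conclusion *)

Lemma S_function_column (R : realType) (N : nat) (x : nat -> R) :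
  S_function N (nseq N 1%N) x = power_expansion (fun k => power_sum k x) N.
Proof.
rewrite /S_function /power_expansion [LHS]big_seq [RHS]big_seq.
apply: eq_bigr => mu muN; rewrite char_value_column //.
have /and3P[_ _ /eqP sum_mu] : is_intpart N mu by rewrite -mem_intparts.
rewrite /power_term sum_mu /class_size -/(centralizer_order N mu).
congr (_ * _); rewrite mulrC; congr (_ * _).
by rewrite -mulrA mulrC -mulrA mulVf ?mulr1 // pnatr_eq0 -lt0n fact_gt0.
Qed.

Theorem theorem2 (R : realType) (N : nat) (beta : R) (eps : nat -> R)
  (hN : (1 <= N)%N)
  (hbeta : 0 < beta)
  (heps : nondecreasing_seq eps)
  (hsum : cvgn (series (fun i => expR (- (beta * eps i))))) :
  Z_FD eps beta N =
  (S_function N (nseq N 1%N) (fun i => expR (- (beta * eps i))))%:E.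
Proof.
pose x i := expR (- (beta * eps i)).
have cvg_p k : (0 < k)%N -> cvgn (series (fun i => x i ^+ k)).
  case: k => // k _.
  (* Since the energies are nondecreasing, x_i <= x_0, so x_i^(k+1) is at most x_0^k x_i. *)
  apply: (series_le_cvg (v_ := fun i => x 0%N ^+ k * x i)).
  - by move=> i; rewrite exprn_ge0 ?expR_ge0.
  - by move=> i; rewrite mulr_ge0 ?exprn_ge0 ?expR_ge0.
  - move=> i; rewrite exprSr ler_wpM2r ?expR_ge0 //.
    rewrite lerXn2r ?nnegrE ?expR_ge0 //.
    by rewrite ler_expR lerN2 ler_pM2l // heps.
  - rewrite (_ : series _ = (fun n => x 0%N ^+ k * series x n)).
      by apply: is_cvgMl_tmp; exact: hsum.
    by apply/funext => n; rewrite /series /= mulr_sumr.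
have := cvg_power_expansion (N := N) cvg_p.
(* The truncated expansions are the truncated partition functions, so both have the same limit. *)
rewrite -S_function_column (funext (power_expansion_elementary x N)) => lim_e.
by rewrite Z_FD_lim;
  [rewrite (cvg_lim _ lim_e)|apply/cvg_ex; eexists; exact: lim_e].
Qed.
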